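(* There exists an online convex optimization algorithm that, given a convex body $\mathcal K\subseteq\mathbb R^d$, a set $M=\{m_1,\dots,m_N\}$ of $|M|=N$ mirror maps on $\mathcal K$, and any sequence of online loss functions $f^{(1)},\dots,f^{(T)}$ such that $\max_{t\in[T],\,x,z\in\mathcal K}f^{(t)}(x)-f^{(t)}(z)\le\rho$, achieves regret at most $$\mathrm{regret}(T)\ \le\ \min_{\ell\in[N]}\mathrm{regret}_{m_\ell}(T)+2\rho\sqrt{T\ln N},$$ as long as $T\ge\ln N$.
   Context: Online convex optimization: $\mathcal K$ is a closed bounded convex set; in round $t=1,\dots,T$ the algorithm plays $x^{(t)}\in\mathcal K$ (depending only on $f^{(1)},\dots,f^{(t-1)}$), after which a convex differentiable loss $f^{(t)}$ is revealed. The loss sequence is fixed in advance (oblivious adversary). Its regret is $\mathrm{regret}(T)=\sum_{t=1}^Tf^{(t)}(x^{(t)})-\min_{x\in\mathcal K}\sum_{t=1}^Tf^{(t)}(x)$. The algorithm is given $T$ and $\rho>0$, the starting point $x^{(1)}\in\mathcal K$, and for each mirror map $m_\ell$ step sizes $\eta_\ell^{(1)},\dots,\eta_\ell^{(T)}>0$. A mirror map $m$ is a strictly convex differentiable function, with Bregman divergence $B_m(x\|y)=m(x)-m(y)-\langle\nabla m(y),x-y\rangle$, for which the mirror-descent step below is well defined. $\mathrm{regret}_{m_\ell}(T)$ is the regret, on the same loss sequence, of online mirror descent with mirror map $m_\ell$: $X_\ell^{(1)}=x^{(1)}$ and $X_\ell^{(t+1)}=\arg\min_{x\in\mathcal K}\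 \eta_\ell^{(t)}\langle\nabla f^{(t)}(X_\ell^{(t)}),x\rangle+B_{m_\ell}(x\|X_\ell^{(t)})$. *)

(* Defs.v *)
(* MathComp / MathComp-Analysis *)
From mathcomp Require Import all_boot all_order all_algebra.
From mathcomp Require Import all_classical all_reals all_analysis.
From mathcomp Require Import lra.

Set Implicit Arguments.
Unset Strict Implicit.
Unset Printing Implicit Defensive.

Import Order.TTheory GRing.Theory Num.Theory.
Import numFieldNormedType.Exports.

Local Open Scope classical_set_scope.
Local Open Scope ring_scope.

Definition inner (R : realType) (d : nat) (u v : 'rV[R]_d) : R :=
  \sum_(i < d) u ord0 i * v ord0 i.

Definition grad (R : realType) (d : nat) (f : 'rV[R]_d -> R) (y : 'rV[R]_d) :
    'rV[R]_d :=
  \row_(i < d) 'D_(delta_mx ord0 i) f y.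

Definition argmin (R : realType) (X : Type) (A : set X) (F : X -> R) : set X :=
  [set x | A x /\ forall z, A z -> F x <= F z].

Definition strictly_convex_on (R : realType) (d : nat) (D : set 'rV[R]_d)
    (m : 'rV[R]_d -> R) : Prop :=
  forall (x y : 'rV[R]_d) (s : R), D x -> D y -> x <> y -> 0 < s < 1 ->
    m (s *: x + (1 - s) *: y) < s * m x + (1 - s) * m y.

Definition bregman (R : realType) (d : nat) (m : 'rV[R]_d -> R)
    (x y : 'rV[R]_d) : R :=
  m x - m y - inner (grad m y) (x - y).

(* The mirror map is [mm_fun] on its effective domain [mm_dom] and +oo outside
   it; in particular minimizing over K amounts to minimizing over
   K `&` mm_dom. If m is differentiable everywhere, [mm_dom = setT]. For the
   negative entropy, which has no gradient on the boundary of the nonnegative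
   orthant, [mm_dom] is that orthant. [mm_step] states that the mirror-descent
   step is well defined: from a point of K where m is differentiable, and for
   any scaled loss gradient g, the minimizer exists (it is unique by strict
   convexity) and m is differentiable there, so that the next step makes
   sense. *)
Record mirror_map (R : realType) (d : nat) (K : set 'rV[R]_d) := MirrorMap {
  mm_fun : 'rV[R]_d -> R ;
  mm_dom : set 'rV[R]_d ;
  mm_convex_dom : convex_set mm_dom ;
  mm_strictly_convex : strictly_convex_on mm_dom mm_fun ;
  mm_differentiable : forall y, interior mm_dom y -> differentiable mm_fun y ;
  mm_step : forall y g : 'rV[R]_d, K y -> interior mm_dom y ->
    exists2 x, interior mm_dom x &
      argmin (K `&` mm_dom) (fun x => inner g x + bregman mm_fun x y) x
}.

(* The data handed to the algorithm before the first round. Rounds are numbered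
   from 0, so [setup_eta l t] is the step size of the (t+1)-st round. *)
Record oco_setup (R : realType) (d : nat) := OcoSetup {
  setup_K : set 'rV[R]_d ;
  setup_K_closed : closed setup_K ;
  setup_K_bounded : bounded_set setup_K ;
  setup_K_convex : convex_set setup_K ;
  setup_N : nat ;
  setup_N_gt0 : (0 < setup_N)%N ;
  setup_M : 'I_setup_N -> mirror_map setup_K ;
  setup_T : nat ;
  setup_rho : R ;
  setup_rho_gt0 : 0 < setup_rho ;
  setup_x1 : 'rV[R]_d ;
  setup_x1_in : setup_K setup_x1 ;
  setup_x1_dom : forall l, interior (mm_dom (setup_M l)) setup_x1 ;
  setup_eta : 'I_setup_N -> nat -> R ;
  setup_eta_gt0 : forall l t, (t < setup_T)%N -> 0 < setup_eta l t
}.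

Arguments setup_M {R d} o l.
Arguments setup_x1_dom {R d} o l.
Arguments setup_eta {R d} o l t.
Arguments setup_eta_gt0 {R d} o l t.

Definition is_loss (R : realType) (d : nat) (K : set 'rV[R]_d)
    (f : 'rV[R]_d -> R) : Prop :=
  convex_function K f /\ forall x, K x -> differentiable f x.

(* The play of a round is a function of the setup and of the list of the losses
   of the previous rounds only. *)
Record online_algorithm (R : realType) := OnlineAlgorithm {
  play : forall d : nat, oco_setup R d -> seq ('rV[R]_d -> R) -> 'rV[R]_d ;
  play_start : forall (d : nat) (S : oco_setup R d),
    play S [::] = setup_x1 S ;
  play_in : forall (d : nat) (S : oco_setup R d) (f : nat -> 'rV[R]_d -> R)
      (t : nat), (t < setup_T S)%N ->
    (forall s, (s < t)%N -> is_loss (setup_K S) (f s)) ->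
    setup_K S (play S (mkseq f t))
}.

Definition plays (R : realType) (A : online_algorithm R) (d : nat)
    (S : oco_setup R d) (f : nat -> 'rV[R]_d -> R) (t : nat) : 'rV[R]_d :=
  play A S (mkseq f t).

(* The infimum is a minimum when K is a nonempty closed bounded set and the
   losses are differentiable on K, see [comparator_min]. *)
Definition regret (R : realType) (d : nat) (K : set 'rV[R]_d) (T : nat)
    (f : nat -> 'rV[R]_d -> R) (x : nat -> 'rV[R]_d) : R :=
  \sum_(t < T) f t (x t) - inf [set \sum_(t < T) f t z | z in K].

(* [omdP] shows that the set [get] picks from is the singleton of the iterate. *)
Fixpoint omd (R : realType) (d : nat) (K : set 'rV[R]_d) (m : mirror_map K)
    (eta : nat -> R) (x1 : 'rV[R]_d) (f : nat -> 'rV[R]_d -> R) (t : nat) :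
    'rV[R]_d :=
  if t is s.+1 then
    let y := omd m eta x1 f s in
    get (argmin (K `&` mm_dom m)
           (fun x => eta s * inner (grad (f s) y) x + bregman (mm_fun m) x y))
  else x1.

Definition omd_regret (R : realType) (d : nat) (S : oco_setup R d)
    (f : nat -> 'rV[R]_d -> R) (l : 'I_(setup_N S)) : R :=
  regret (setup_K S) (setup_T S) f
    (omd (setup_M S l) (setup_eta S l) (setup_x1 S) f).

Arguments omd_regret {R d} S f l.

(* [Num.min] has no neutral element in R; the iterated minimum starts from the
   value at index 0. *)
Definition min_ord (R : realType) (N : nat) (N_gt0 : (0 < N)%N)
    (F : 'I_N -> R) : R :=
  \big[Num.min/F (Ordinal N_gt0)]_(l < N) F l.

Lemma comparator_min (R : realType) (d : nat) (K : set 'rV[R]_d) (T : nat)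
    (f : nat -> 'rV[R]_d -> R) :
  K !=set0 -> closed K -> bounded_set K ->
  (forall t, (t < T)%N -> is_loss K (f t)) ->
  exists2 z, K z & argmin K (fun x => \sum_(t < T) f t x) z /\
    inf [set \sum_(t < T) f t x | x in K] = \sum_(t < T) f t z.
Proof.
move=> K0 clK bK fK.
have [z zK zmin] : exists2 z, z \in K &
    forall x, x \in K -> \sum_(t < T) f t z <= \sum_(t < T) f t x.
  apply: (@compact_EVT_min _ R (fun x => \sum_(t < T) f t x) K K0).
    exact: bounded_closed_compact.
  apply: continuous_in_subspaceT => x; rewrite inE => Kx.
  apply: differentiable_continuous.
  have -> : (fun x => \sum_(t < T) f t x) = \sum_(t < T) f t.
    by apply/funext => y; rewrite fct_sumE.
  apply: differentiable_sum => i; exact: (fK i (ltn_ord i)).2.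
rewrite inE in zK.
have zmin' x : K x -> \sum_(t < T) f t z <= \sum_(t < T) f t x.
  by move=> Kx; apply: zmin; rewrite inE.
exists z => //; split=> //; apply/eqP; rewrite eq_le; apply/andP; split.
- apply: ge_inf; last by exists z.
  by exists (\sum_(t < T) f t z) => _ [x Kx <-]; exact: zmin'.
- apply: lb_le_inf; first by exists (\sum_(t < T) f t z); exists z.
  by move=> _ [x Kx <-]; exact: zmin'.
Qed.

Lemma min_ord_attained (R : realType) (N : nat) (N_gt0 : (0 < N)%N)
    (F : 'I_N -> R) :
  (exists l, min_ord N_gt0 F = F l) /\ forall l, min_ord N_gt0 F <= F l.
Proof.
rewrite /min_ord; split; last by move=> l; rewrite (bigD1 l)//= ge_min lexx.
apply: (big_ind (fun y => exists l, y = F l)).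
- by exists (Ordinal N_gt0).
- by move=> _ _ [a ->] [b ->]; rewrite minEle; case: ifP => _; [exists a|exists b].
- by move=> l _; exists l.
Qed.

Section Omd.
Variables (R : realType) (d : nat) (K : set 'rV[R]_d) (m : mirror_map K).
Hypothesis Kconvex : convex_set K.

Lemma innerDr (g x y : 'rV[R]_d) : inner g (x + y) = inner g x + inner g y.
Proof. by rewrite /inner -big_split/=; apply: eq_bigr => i _; rewrite mxE mulrDr. Qed.

Lemma innerZr (g x : 'rV[R]_d) c : inner g (c *: x) = c * inner g x.
Proof. by rewrite /inner mulr_sumr; apply: eq_bigr => i _; rewrite mxE mulrCA. Qed.

Lemma innerZl (g x : 'rV[R]_d) c : inner (c *: g) x = c * inner g x.
Proof. by rewrite /inner mulr_sumr; apply: eq_bigr => i _; rewrite mxE mulrA. Qed.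

Lemma convex_setP (A : set 'rV[R]_d) (x y : 'rV[R]_d) (s : R) :
  convex_set A -> A x -> A y -> 0 < s < 1 -> A (s *: x + (1 - s) *: y).
Proof.
move=> cA Ax Ay /andP[s0 s1].
have s01 : Itv.spec (@Itv.num_sem R) (Itv.Real `[0%Z, 1%Z]) s.
  by rewrite /= /Itv.num_sem/= num_real/= in_itv/= !ltW.
pose l : {i01 R} := Itv.mk s01.
have := cA x y l; rewrite !inE => /(_ Ax Ay).
exact.
Qed.

Lemma omd_argmin_uniq (g y x z : 'rV[R]_d) :
  let F := fun x => inner g x + bregman (mm_fun m) x y in
  argmin (K `&` mm_dom m) F x -> argmin (K `&` mm_dom m) F z -> x = z.
Proof.
move=> F [[Kx Dx] minx] [[Kz Dz] minz]; apply: contrapT => xz.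
have h : 0 < (2^-1 : R) < 1 by rewrite invr_gt0 ltr0n invf_lt1 ?ltr1n.
have Kw := convex_setP Kconvex Kx Kz h.
have Dw := convex_setP (mm_convex_dom (m := m)) Dx Dz h.
have := mm_strictly_convex Dx Dz xz h.
have := minx _ (conj Kw Dw); have := minz _ (conj Kw Dw).
rewrite /F /bregman !innerDr !innerZr -(scaleN1r y) !innerZr.
lra.
Qed.

Variables (eta : nat -> R) (x1 : 'rV[R]_d) (f : nat -> 'rV[R]_d -> R).
Hypotheses (Kx1 : K x1) (Dx1 : interior (mm_dom m) x1).

Lemma omdP (t : nat) :
  let X := omd m eta x1 f in
  [/\ K (X t), interior (mm_dom m) (X t) &
    argmin (K `&` mm_dom m) (fun x => eta t * inner (grad (f t) (X t)) x
      + bregman (mm_fun m) x (X t)) = [set X t.+1]].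
Proof.
move=> X.
have step s : K (X s) -> interior (mm_dom m) (X s) ->
    interior (mm_dom m) (X s.+1) /\
    argmin (K `&` mm_dom m) (fun x => eta s * inner (grad (f s) (X s)) x
      + bregman (mm_fun m) x (X s)) = [set X s.+1].
  move=> Ks Ds.
  have [x Dx Ax] := mm_step (eta s *: grad (f s) (X s)) Ks Ds.
  have E : (fun x => inner (eta s *: grad (f s) (X s)) x
        + bregman (mm_fun m) x (X s)) =
      (fun x => eta s * inner (grad (f s) (X s)) x
        + bregman (mm_fun m) x (X s)).
    by apply/funext => z; rewrite innerZl.
  have -> : X s.+1 = x.
    apply: (@omd_argmin_uniq (eta s *: grad (f s) (X s)) (X s)) => //.
    by rewrite E in Ax *; exact: (xgetPex point (ex_intro _ x Ax)).
  split=> //; rewrite -E; apply/seteqP; split=> [z Az|z ->]//=.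
  exact: omd_argmin_uniq Az Ax.
have inv : K (X t) /\ interior (mm_dom m) (X t).
  elim: t => [//|s [Ks Ds]]; have [Ds1 Es] := step _ Ks Ds.
  split=> //.
  have : [set X s.+1] (X s.+1) by [].
  by rewrite -Es => -[[]].
by case: inv => Kt Dt; have [] := step _ Kt Dt.
Qed.

End Omd.

(* Main.v *)
Require Import Defs.
From mathcomp Require Import all_boot all_order all_algebra.
From mathcomp Require Import all_classical all_reals all_analysis.
From mathcomp Require Import ring lra.
Import Order.TTheory GRing.Theory Num.Theory.
Import numFieldNormedType.Exports.
Local Open Scope classical_set_scope.
Local Open Scope ring_scope.

(** The algorithm runs the [N] mirror descents side by side and treats them as
    experts for the exponential-weights (Hedge) forecaster: it plays the average
    of the current iterates [X_l], where [X_l] is weighted by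
    [exp (- e * L_l)] and [L_l] is the loss that the [l]-th descent has
    accumulated so far. The comparator of the regret is common to the algorithm
    and to the descents, so it cancels, and two facts remain.

    - Convexity ([wavg_convex_function]): the loss of the average iterate is at
      most the average of the losses of the iterates. Hence it suffices to bound
      the regret of Hedge against the best expert on the vectors
      [g_t l = f_t (X_l)], whose oscillation over [l] is at most [rho].

    - The Hedge bound ([hedge_regret]): let [W_t] be the total weight. If the
      losses of round [t] are written as [c + v] with [c] their minimum, so that
      [0 <= v <= rho], then [exp (- x) <= 1 - x + x ^ 2] for [x >= 0] yields
      [W_(t+1) <= W_t * exp (- e * avg_t + (e * rho) ^ 2)], where [avg_t] is the
      average loss of the round. Multiplying over the rounds, and bounding the
      final total weight from below by the weight of a single expert [k], gives
      [e * (sum_t avg_t - L_k) <= ln N + T * (e * rho) ^ 2].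

    The two terms on the right are balanced at [e = sqrt (ln N / T) / rho],
    which gives [2 * rho * sqrt (T * ln N)]. *)

(** * Weighted averages *)

(** Normalization is part of the average, so that the exponential weights can be
    used as they are. *)
Definition wavg {R : realType} {E : lmodType R} {n : nat} (w : 'I_n -> R)
    (x : 'I_n -> E) : E :=
  (\sum_i w i)^-1 *: \sum_i w i *: x i.

Section WeightedAverage.
Context {R : realType} {E : lmodType R}.

Lemma sum_weights_gt0 {n : nat} {w : 'I_n -> R} :
  (0 < n)%N -> (forall i, 0 < w i) -> 0 < \sum_i w i.
Proof.
case: n w => // n w _ w0; rewrite big_ord_recl ltr_wpDr//.
by apply: sumr_ge0 => i _; exact: ltW.
Qed.

Lemma wavg_const {n : nat} (w : 'I_n -> R) (x : 'I_n -> E) (y : E) :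
  (0 < n)%N -> (forall i, 0 < w i) -> (forall i, x i = y) -> wavg w x = y.
Proof.
move=> n0 w0 xy; rewrite /wavg (eq_bigr (fun i => w i *: y)) => [|i _].
  by rewrite -scaler_suml scalerA mulVf ?scale1r// gt_eqF// sum_weights_gt0.
by rewrite xy.
Qed.

Lemma convex_set_avg2 (A : set E) (a b : R) (x y : E) :
  convex_set A -> 0 < a -> 0 < b -> A x -> A y ->
  A ((a + b)^-1 *: (a *: x + b *: y)).
Proof.
move=> cA a0 b0 Ax Ay; have ab0 : 0 < a + b by rewrite addr_gt0.
have s01 : Itv.spec (@Itv.num_sem R) (Itv.Real `[0%Z, 1%Z]) (a / (a + b)).
  rewrite /= /Itv.num_sem/= num_real/= in_itv/= divr_ge0 ?ltW//=.
  by rewrite ltr_pdivrMr// mul1r ltrDl.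
pose l : {i01 R} := Itv.mk s01.
have := cA x y l; rewrite !inE => /(_ Ax Ay).
congr A; rewrite scalerDr !scalerA; congr (_ *: _ + _ *: _).
  by rewrite /= mulrC.
by rewrite /= /unstable.onem; field; rewrite gt_eqF.
Qed.

Lemma wavg_convex_set {n : nat} (A : set E) (w : 'I_n -> R) (x : 'I_n -> E) :
  convex_set A -> (0 < n)%N -> (forall i, 0 < w i) -> (forall i, A (x i)) ->
  A (wavg w x).
Proof.
move=> cA; elim: n w x => // -[|n] IH w x _ w0 Ax.
  by rewrite (wavg_const _ _ (x ord0))// => i; rewrite (ord1 i).
pose w' i := w (lift ord0 i); pose x' i := x (lift ord0 i).
have W0 : 0 < \sum_i w' i by apply: sum_weights_gt0 => // i; exact: w0.
rewrite /wavg big_ord_recl [X in _ *: X]big_ord_recl.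
have -> : \sum_(i < n.+1) w (lift ord0 i) *: x (lift ord0 i) =
    (\sum_i w' i) *: wavg w' x'.
  by rewrite /wavg scalerA mulfV ?scale1r// gt_eqF.
apply: convex_set_avg2 => //.
by apply: IH => // i; [exact: w0|exact: Ax].
Qed.

End WeightedAverage.

(** Jensen's inequality is the stability of the epigraph of [f], a convex subset
    of [E * R], under weighted averages. *)
Lemma wavg_convex_function {R : realType} {E : lmodType R} {n : nat} (A : set E)
    (f : E -> R) (w : 'I_n -> R) (x : 'I_n -> E) :
  convex_set A -> convex_function A f ->
  (0 < n)%N -> (forall i, 0 < w i) -> (forall i, A (x i)) ->
  f (wavg w x) <= wavg w (fun i => f (x i) : R^o).
Proof.
move=> cA cf n0 w0 Ax.
pose epi : set (E * R^o)%type := [set p | A p.1 /\ f p.1 <= p.2].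
have cepi : convex_set epi.
  move=> [x1 r1] [x2 r2] l; rewrite !inE => -[/= A1 f1] [/= A2 f2].
  split => /=.
    by have := cA x1 x2 l; rewrite !inE; apply.
  have := cf l x1 x2; rewrite !inE => /(_ A1 A2) /le_trans; apply.
  have l1 : 0 <= 1 - l%:num by rewrite subr_ge0.
  exact: lerD (ler_wpM2l (ge0 l) f1) (ler_wpM2l l1 f2).
have [_] : epi (wavg w (fun i => (x i, f (x i) : R^o))).
  by apply: wavg_convex_set => // i; split => //=.
suff -> : wavg w (fun i => (x i, f (x i) : R^o)) =
    (wavg w x, wavg w (fun i => f (x i) : R^o)) by [].
have sumE (p : seq 'I_n) : \sum_(i <- p) w i *: ((x i, f (x i)) : E * R^o) =
    (\sum_(i <- p) w i *: x i, \sum_(i <- p) w i *: (f (x i) : R^o)).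
  by elim: p => [|i p IH]; rewrite ?big_nil// !big_cons IH.
by rewrite /wavg sumE.
Qed.

(** * Exponential weights *)

Section Hedge.
Context {R : realType}.

Lemma expRN_le_quadratic (v : R) : 0 <= v -> expR (- v) <= 1 - v + v ^+ 2.
Proof.
move=> v0; rewrite expRN.
(* (1 + v) * (1 - v + v ^ 2) = 1 + v ^ 3 >= 1 *)
have v1 : 0 < 1 + v by lra.
apply: (@le_trans _ _ (1 + v)^-1).
  by rewrite lef_pV2 ?posrE ?expR_gt0// expR_ge1Dx.
rewrite -[leLHS]mul1r ler_pdivrMr//.
have : 0 <= v ^+ 3 by rewrite exprn_ge0.
nra.
Qed.

Definition hedge_rate (n T : nat) (rho : R) : R :=
  Num.sqrt (ln n%:R / T%:R) / rho.

Context {n : nat}.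
Implicit Types (g : nat -> 'I_n -> R) (e rho : R).

Definition hedge_weight e g (t : nat) (l : 'I_n) : R :=
  expR (- e * \sum_(s < t) g s l).

Definition hedge_loss e g (t : nat) : R :=
  wavg (hedge_weight e g t) (fun l => g t l : R^o).

Lemma hedge_weight_gt0 e g t l : 0 < hedge_weight e g t l.
Proof. exact: expR_gt0. Qed.

(** The total weight decreases at least as if every expert had suffered the
    average loss, up to the second-order term of the exponential. *)
Lemma hedge_potential_step e rho g (t : nat) :
  (0 < n)%N -> 0 <= e -> (forall l k, g t l - g t k <= rho) ->
  \sum_l hedge_weight e g t.+1 l <=
  (\sum_l hedge_weight e g t l) *
    expR (- e * hedge_loss e g t + (e * rho) ^+ 2).
Proof.
move=> n0 e0 osc; pose w := hedge_weight e g t.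
have [k _ kmin] := @arg_minP _ _ _ (Ordinal n0) predT (g t) isT.
set c := g t k in kmin.
have W0 : 0 < \sum_l w l.
  by apply: sum_weights_gt0 => // l; exact: hedge_weight_gt0.
have -> : expR (- e * hedge_loss e g t + (e * rho) ^+ 2) =
    expR (- e * c) * expR (- e * (hedge_loss e g t - c) + (e * rho) ^+ 2).
  by rewrite -expRD; congr expR; ring.
have lossE : (\sum_l w l) * hedge_loss e g t = \sum_l w l * g t l.
  by rewrite /hedge_loss /wavg -/w [LHS]mulrA mulfV ?mul1r// gt_eqF.
have step l : hedge_weight e g t.+1 l <= expR (- e * c) *
    (w l * (1 + e * c + (e * rho) ^+ 2) - e * (w l * g t l)).
  have cg : 0 <= g t l - c by rewrite subr_ge0 kmin.
  have -> : hedge_weight e g t.+1 l =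
      expR (- e * c) * (w l * expR (- (e * (g t l - c)))).
    rewrite /hedge_weight big_ord_recr/= /w /hedge_weight -!expRD.
    by congr expR; ring.
  rewrite ler_pM2l ?expR_gt0//.
  have -> : w l * (1 + e * c + (e * rho) ^+ 2) - e * (w l * g t l) =
      w l * (1 - e * (g t l - c) + (e * rho) ^+ 2) by ring.
  rewrite ler_pM2l ?hedge_weight_gt0//.
  have v0 : 0 <= e * (g t l - c) by rewrite mulr_ge0.
  apply: le_trans (expRN_le_quadratic _ v0) _.
  rewrite lerD2l lerXn2r ?nnegrE ?ler_wpM2l ?osc//.
  by rewrite mulr_ge0// (le_trans cg) ?osc.
apply: le_trans (ler_sum _ (fun l _ => step l)) _.
rewrite -mulr_sumr sumrB -mulr_suml -mulr_sumr -lossE [leRHS]mulrCA.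
rewrite ler_pM2l ?expR_gt0//.
have -> : (\sum_l w l) * (1 + e * c + (e * rho) ^+ 2) -
    e * ((\sum_l w l) * hedge_loss e g t) =
    (\sum_l w l) * (1 + (- e * (hedge_loss e g t - c) + (e * rho) ^+ 2)).
  by ring.
by rewrite ler_pM2l// expR_ge1Dx.
Qed.

Lemma hedge_potential e rho g (T : nat) :
  (0 < n)%N -> 0 <= e ->
  (forall t l k, (t < T)%N -> g t l - g t k <= rho) ->
  \sum_l hedge_weight e g T l <=
  n%:R * expR (- e * \sum_(t < T) hedge_loss e g t + T%:R * (e * rho) ^+ 2).
Proof.
move=> n0 e0; elim: T => [_|T IH osc].
  rewrite big_ord0 mulr0 mul0r addr0 expR0 mulr1.
  under eq_bigr do rewrite /hedge_weight big_ord0 mulr0 expR0.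
  by rewrite sumr_const card_ord.
apply: le_trans (@hedge_potential_step e rho g T n0 e0 _) _.
  by move=> l k; exact: osc.
rewrite big_ord_recr/= -natr1.
have -> : - e * (\sum_(t < T) hedge_loss e g t + hedge_loss e g T) +
    (T%:R + 1) * (e * rho) ^+ 2 =
    - e * (\sum_(t < T) hedge_loss e g t) + T%:R * (e * rho) ^+ 2 +
    (- e * hedge_loss e g T + (e * rho) ^+ 2) by ring.
rewrite [in leRHS]expRD [leRHS]mulrA ler_pM2r ?expR_gt0//.
by apply: IH => t l k tT; apply: osc; exact: ltnW.
Qed.

Lemma hedge_regret e rho g (T : nat) (k : 'I_n) :
  0 <= e ->
  (forall t l l', (t < T)%N -> g t l - g t l' <= rho) ->
  e * (\sum_(t < T) hedge_loss e g t - \sum_(t < T) g t k) <=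
  ln n%:R + T%:R * (e * rho) ^+ 2.
Proof.
move=> e0 osc; have n0 : (0 < n)%N by case: n k => [[]|].
have wkW : hedge_weight e g T k <= \sum_l hedge_weight e g T l.
  rewrite (bigD1 k)//= lerDl sumr_ge0// => l _.
  exact/ltW/hedge_weight_gt0.
have := le_trans wkW (hedge_potential _ _ _ _ n0 e0 osc).
rewrite /hedge_weight -[X in X * expR _]lnK ?posrE ?ltr0n// -expRD ler_expR.
lra.
Qed.

(** When [ln n = 0] or [T = 0] the tuned rate vanishes and [hedge_regret] carries
    no information, but then there is a single expert or no round. *)
Lemma hedge_regret_tuned rho g (T : nat) (k : 'I_n) :
  0 < rho ->
  (forall t l l', (t < T)%N -> g t l - g t l' <= rho) ->
  \sum_(t < T) hedge_loss (hedge_rate n T rho) g t - \sum_(t < T) g t k <=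
  2 * rho * Num.sqrt (T%:R * ln n%:R).
Proof.
move=> rho0 osc; set e := hedge_rate n T rho.
have n0 : (0 < n)%N by case: n k => [[]|].
have [T0|T0] := posnP T.
  by rewrite T0 !big_ord0 subrr mul0r sqrtr0 mulr0.
have [n1|n1] := leqP n 1.
  have En : n = 1%N by apply/eqP; rewrite eqn_leq n1 n0.
  have ord_eq0 (i : 'I_n) : i = 0 :> nat.
    by apply/eqP; rewrite -leqn0 -ltnS (leq_trans (ltn_ord i)).
  rewrite En ln1 mulr0 sqrtr0 mulr0 subr_le0.
  apply: ler_sum => t _; rewrite /hedge_loss (wavg_const _ _ (g t k))//.
    by move=> l; exact: hedge_weight_gt0.
  by move=> l; congr g; apply: val_inj; rewrite /= !ord_eq0.
have T0R : 0 < T%:R :> R by rewrite ltr0n.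
have lnn : 0 < ln n%:R :> R by rewrite ln_gt0// ltr1n.
pose s := Num.sqrt (ln n%:R / T%:R) : R.
have s0 : 0 < s by rewrite sqrtr_gt0 divr_gt0.
have lnE : ln n%:R = T%:R * s ^+ 2.
  by rewrite sqr_sqrtr ?divr_ge0 ?ltW// mulrC divfK// gt_eqF.
have -> : Num.sqrt (T%:R * ln n%:R) = T%:R * s.
  by rewrite lnE mulrA -expr2 -exprMn sqrtr_sqr ger0_norm// mulr_ge0 ?ltW.
have e0 : 0 < e by rewrite divr_gt0.
have eE : e * rho = s by rewrite divfK// gt_eqF.
have := @hedge_regret e rho g T k (ltW e0) osc.
rewrite eE lnE => H; rewrite -(ler_pM2l e0); apply: le_trans H _.
have -> : e * (2 * rho * (T%:R * s)) = 2 * (e * rho) * T%:R * s by ring.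
rewrite eE; lra.
Qed.

End Hedge.

(** * Hedge over mirror descents *)

(** The iterate of round [t] only sees the losses of the rounds before [t]. *)
Lemma omd_causal {R : realType} {d : nat} {K : set 'rV[R]_d} (m : mirror_map K)
    (eta : nat -> R) (x1 : 'rV[R]_d) (f f' : nat -> 'rV[R]_d -> R) (t : nat) :
  (forall s, (s < t)%N -> f s = f' s) -> omd m eta x1 f t = omd m eta x1 f' t.
Proof.
elim: t => //= t IH ff'; rewrite IH => [|s st]; last by rewrite ff'// ltnW.
by rewrite ff'.
Qed.

Section HedgeOverDescents.
Context {R : realType} {d : nat}.
Implicit Types (S : oco_setup R d) (f : nat -> 'rV[R]_d -> R).

Definition omd_iterate S f (t : nat) (l : 'I_(setup_N S)) : 'rV[R]_d :=
  omd (setup_M S l) (setup_eta S l) (setup_x1 S) f t.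

Definition omd_loss S f (t : nat) (l : 'I_(setup_N S)) : R :=
  f t (omd_iterate S f t l).

Definition setup_rate S : R :=
  hedge_rate (setup_N S) (setup_T S) (setup_rho S).

Definition hedge_point S f (t : nat) : 'rV[R]_d :=
  wavg (hedge_weight (setup_rate S) (omd_loss S f) t) (omd_iterate S f t).

Lemma omd_iterate_in S f t l : setup_K S (omd_iterate S f t l).
Proof.
by have [] := omdP (@setup_K_convex _ _ S) (setup_eta S l) f
  (@setup_x1_in _ _ S) (setup_x1_dom S l) t.
Qed.

Lemma hedge_point_causal S f f' t :
  (forall s, (s < t)%N -> f s = f' s) -> hedge_point S f t = hedge_point S f' t.
Proof.
move=> ff'; rewrite /hedge_point; congr wavg; apply/funext => l.
  congr (expR (_ * _)); apply: eq_bigr => s _.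
  rewrite /omd_loss /omd_iterate ff'//; congr f'.
  by apply: omd_causal => r rs; rewrite ff'// (ltn_trans rs).
exact: omd_causal.
Qed.

Lemma hedge_point_start S f : hedge_point S f 0 = setup_x1 S.
Proof.
by apply: wavg_const => [|l|l]; [exact: setup_N_gt0|exact: hedge_weight_gt0|].
Qed.

Lemma hedge_point_in S f t : setup_K S (hedge_point S f t).
Proof.
apply: wavg_convex_set => [||l|l].
- exact: setup_K_convex.
- exact: setup_N_gt0.
- exact: hedge_weight_gt0.
- exact: omd_iterate_in.
Qed.

Lemma hedge_point_loss S f t :
  is_loss (setup_K S) (f t) ->
  f t (hedge_point S f t) <= hedge_loss (setup_rate S) (omd_loss S f) t.
Proof.
case=> cf _.
apply: (wavg_convex_function _ _ _ _ (@setup_K_convex _ _ S) cf) => [|l|l].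
- exact: setup_N_gt0.
- exact: hedge_weight_gt0.
- exact: omd_iterate_in.
Qed.

Lemma hedge_point_regret S f l :
  (forall t, (t < setup_T S)%N -> is_loss (setup_K S) (f t)) ->
  (forall t x z, (t < setup_T S)%N -> setup_K S x -> setup_K S z ->
     f t x - f t z <= setup_rho S) ->
  regret (setup_K S) (setup_T S) f (hedge_point S f) <=
  omd_regret S f l +
  2 * setup_rho S * Num.sqrt ((setup_T S)%:R * ln (setup_N S)%:R).
Proof.
move=> lossf oscf.
have osc t l1 l2 : (t < setup_T S)%N ->
    omd_loss S f t l1 - omd_loss S f t l2 <= setup_rho S.
  by move=> tT; apply: oscf => //; exact: omd_iterate_in.
have := hedge_regret_tuned _ (omd_loss S f) (setup_T S) l
  (@setup_rho_gt0 _ _ S) osc.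
have : \sum_(t < setup_T S) f t (hedge_point S f t) <=
    \sum_(t < setup_T S) hedge_loss (setup_rate S) (omd_loss S f) t.
  by apply: ler_sum => t _; apply/hedge_point_loss/lossf.
rewrite /omd_regret /regret /omd_loss /omd_iterate /setup_rate /=.
lra.
Qed.

End HedgeOverDescents.

(** The past losses arrive as a list, which is extended by zero to a sequence of
    losses; by causality the values of the extension do not matter. *)
Definition hedge_play {R : realType} {d : nat} (S : oco_setup R d)
    (past : seq ('rV[R]_d -> R)) : 'rV[R]_d :=
  hedge_point S (nth (fun=> 0) past) (size past).

Lemma hedge_play_mkseq {R : realType} {d : nat} (S : oco_setup R d)
    (f : nat -> 'rV[R]_d -> R) (t : nat) :
  hedge_play S (mkseq f t) = hedge_point S f t.
Proof.
rewrite /hedge_play size_mkseq.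
by apply: hedge_point_causal => s st; rewrite nth_mkseq.
Qed.

Definition hedge_algorithm (R : realType) : online_algorithm R.
Proof.
apply: (@OnlineAlgorithm R (fun d S past => hedge_play S past)) => d S.
  exact: hedge_point_start.
by move=> f t _ _; rewrite hedge_play_mkseq; exact: hedge_point_in.
Defined.

Theorem theorem4 (R : realType) :
  exists A : online_algorithm R,
    forall (d : nat) (S : oco_setup R d) (f : nat -> 'rV[R]_d -> R),
      (forall t, (t < setup_T S)%N -> is_loss (setup_K S) (f t)) ->
      (forall t x z, (t < setup_T S)%N -> setup_K S x -> setup_K S z ->
         f t x - f t z <= setup_rho S) ->
      ln (setup_N S)%:R <= (setup_T S)%:R :> R ->
      regret (setup_K S) (setup_T S) f (plays A S f) <=
        min_ord (setup_N_gt0 S) (omd_regret S f) +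
        2 * setup_rho S * Num.sqrt ((setup_T S)%:R * ln (setup_N S)%:R).
Proof.
exists (hedge_algorithm R) => d S f lossf oscf _.
have -> : plays (hedge_algorithm R) S f = hedge_point S f.
  by apply/funext => t; exact: hedge_play_mkseq.
have [[l ->] _] := min_ord_attained (setup_N_gt0 S) (omd_regret S f).
exact: hedge_point_regret.
Qed.
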